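(* Let $Y$ be a random variable uniformly distributed on $(0,1)$, let $0<q<1$, $x\in[0,1]$, and let $n,r$ be integers with $0\le r\le n$. Then $$B_{r,n}^{Y}(x,q)=\binom{n}{r}[x]_q^{r}\,B_{n-r}^{([x]_{q^{-1}}-1)}.$$
   Context: $q$-numbers: $[x]_q=\frac{q^x-1}{q-1}$ and $[x]_{q^{-1}}=\frac{q^{-x}-1}{q^{-1}-1}$; one has $[1-x]_q=1-[x]_{q^{-1}}$. Probabilistic $q$-Bernstein polynomials $B_{r,n}^Y(x,q)$ associated with $Y$: $\sum_{n=r}^{\infty}B_{r,n}^{Y}(x,q)\frac{v^n}{n!}=\frac{(v[x]_q)^r}{r!}\left(\mathrm{E}[e^{vY}]\right)^{[1-x]_q}$, where the power is the power series in $v$ with constant term $1$. For $Y\sim U(0,1)$, $\mathrm{E}[e^{vY}]=\frac{e^v-1}{v}$. Bernoulli numbers of real order $s$, $B_n^{(s)}=B_n^{(s)}(0)$: $\sum_{n=0}^{\infty}B_n^{(s)}\frac{v^n}{n!}=\left(\frac{v}{e^v-1}\right)^{s}$ (power series with constant term $1$). *)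

(* Defs.v *)
From HB Require Import structures.
From mathcomp Require Import all_boot all_order all_algebra.
From mathcomp Require Import all_classical all_reals all_analysis.

Set Implicit Arguments.
Unset Strict Implicit.
Unset Printing Implicit Defensive.

Import Order.TTheory GRing.Theory Num.Theory.
Import numFieldNormedType.Exports.

Local Open Scope classical_set_scope.
Local Open Scope ring_scope.

Definition qnum (R : realType) (q x : R) : R := (q `^ x - 1) / (q - 1).

(* A formal power series in v is its coefficient sequence: [f k] is the
   coefficient of v^k (not of v^k / k!). *)
Definition fps (R : realType) := nat -> R.

Definition fps1 (R : realType) : fps R := fun n => (n == 0%N)%:R.

Definition fps_sub (R : realType) (f g : fps R) : fps R := fun n => f n - g n.

Definition fps_mul (R : realType) (f g : fps R) : fps R :=
  fun n => \sum_(i < n.+1) f i * g (n - i)%N.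

Definition fps_expn (R : realType) (f : fps R) (k : nat) : fps R :=
  iter k (fps_mul f) (fps1 R).

Definition fps_poly (R : realType) (p : {poly R}) : fps R := fun n => p`_n.

Definition fps_taylor (R : realType) (f : R -> R) : fps R :=
  fun n => (derive1n n f 0) / n`!%:R.

(* 1/f for f with constant term 1: the geometric series
   \sum_k (1 - f)^k.  The terms with k > n do not contribute to the
   coefficient of v^n since (1 - f)^k is then divisible by v^k. *)
Definition fps_inv (R : realType) (f : fps R) : fps R :=
  fun n => \sum_(k < n.+1) fps_expn (fps_sub (fps1 R) f) k n.

Definition gbinom (R : realType) (s : R) (k : nat) : R :=
  (\prod_(i < k) (s - i%:R)) / k`!%:R.

(* f^s for f with constant term 1 and s real: Newton's binomial series
   \sum_k gbinom s k (f - 1)^k, which has constant term 1.  As above, the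
   terms with k > n vanish at order n. *)
Definition fps_powr (R : realType) (f : fps R) (s : R) : fps R :=
  fun n => \sum_(k < n.+1) gbinom s k * fps_expn (fps_sub f (fps1 R)) k n.

(* E[e^{vY}] expanded in powers of v at 0 *)
Definition mgf_fps d (T : measurableType d) (R : realType)
    (P : probability T R) (Y : {RV P >-> R}) : fps R :=
  fps_taylor (fun v : R => fine ('M_P Y v)).

Definition prob_qBernstein d (T : measurableType d) (R : realType)
    (P : probability T R) (Y : {RV P >-> R}) (r n : nat) (x q : R) : R :=
  n`!%:R *
  fps_mul (fps_poly ((r`!%:R)^-1 *: (qnum q x *: 'X) ^+ r))
          (fps_powr (mgf_fps Y) (qnum q (1 - x))) n.

(* (e^v - 1) / v = \sum_k v^k / (k+1)! *)
Definition expm1_div (R : realType) : fps R := fun k => (k.+1`!%:R)^-1.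

(* v / (e^v - 1) is the inverse of (e^v - 1) / v *)
Definition bernoulli (R : realType) (s : R) (n : nat) : R :=
  n`!%:R * fps_powr (fps_inv (expm1_div R)) s n.

(* The law is compared on Borel sets only: outside the sigma-algebra the
   values of [distribution P Y] and [uniform_prob] carry no meaning.  The
   library's uniform law lives on [0, 1], whose endpoints are null. *)
Definition uniform01 d (T : measurableType d) (R : realType)
    (P : probability T R) (Y : {RV P >-> R}) : Prop :=
  forall A : set R, measurable A ->
    distribution P Y A = uniform_prob (@ltr01 R) A.

(* Main.v *)
(* Since E[e^{vY}] = (e^v - 1)/v and [1-x]_q = -([x]_{q^-1} - 1), the theorem
   reduces to (1/f)^(-s) = f^s for f with constant term 1.  Modulo v^(N+1) a
   series is a polynomial, and Newton's series satisfies f * f^s = f^(s+1) by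
   Pascal's rule; hence both powers equal f^m at s = m natural, and the
   coefficients, being polynomials in s, agree for every real s.  The Taylor
   coefficients of E[e^{vY}] come from differentiating under the integral: the
   n-th derivative at 0 is the n-th moment 1/(n+1). *)
Require Import Defs.
From mathcomp Require Import all_boot all_order all_algebra.
From mathcomp Require Import ring.
From mathcomp Require Import all_classical all_reals all_analysis.
From mathcomp Require Import measurable_realfun.

Set Implicit Arguments.
Unset Strict Implicit.
Unset Printing Implicit Defensive.

Import Order.TTheory GRing.Theory Num.Theory.
Import numFieldNormedType.Exports.

Local Open Scope classical_set_scope.
Local Open Scope ring_scope.

(** * Newton's binomial series modulo a power of ['X] *)

Section NewtonSeries.
Variable R : realType.
Implicit Types (U V p : {poly R}) (s : R) (N : nat).

(** Truncation of $(1+U)^s$. Being a polynomial, it lets congruence modulo $v^{N+1}$ be stated as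
    divisibility by ['X^(N.+1)]. *)
Definition newton N s U : {poly R} := \sum_(k < N.+1) gbinom s k *: U ^+ k.

Lemma gbinom0 s : gbinom s 0 = 1.
Proof. by rewrite /gbinom big_ord0 fact0 invr1 mulr1. Qed.

Lemma gbinom_pascal s k : gbinom (s + 1) k.+1 = gbinom s k + gbinom s k.+1.
Proof.
rewrite /gbinom big_ord_recl big_ord_recr /= subr0.
under eq_bigr => i _ do rewrite /bump /= -natr1 opprD addrACA subrr addr0.
have fk : k`!%:R != 0 :> R by rewrite pnatr_eq0 -lt0n fact_gt0.
have k1 : k.+1%:R != 0 :> R by rewrite pnatr_eq0.
rewrite factS natrM -natr1 in k1 *.
field.
by rewrite k1 fk.
Qed.

Lemma gbinom0S k : gbinom (0 : R) k.+1 = 0.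
Proof. by rewrite /gbinom big_ord_recl subr0 !mul0r. Qed.

Lemma newton0 N U : newton N 0 U = 1.
Proof.
rewrite /newton big_ord_recl gbinom0 scale1r big1 ?addr0 // => i _.
by rewrite gbinom0S scale0r.
Qed.

(** Pascal's rule merges the series with its shift by $U$; only the top term of the shifted sum
    finds no partner. *)
Lemma newtonD1 N s U :
  (1 + U) * newton N s U = newton N (s + 1) U + gbinom s N *: U ^+ N.+1.
Proof.
rewrite mulrDl mul1r {2}/newton mulr_sumr big_ord_recr /= /newton.
rewrite addrA -scalerAr -exprS; congr (_ + _).
rewrite big_ord_recl [RHS]big_ord_recl !gbinom0 -addrA; congr (_ + _).
rewrite -big_split; apply: eq_bigr => i _ /=.
by rewrite /bump /= add1n gbinom_pascal -scalerAr -exprS scalerDl addrC.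
Qed.

Lemma dvdX_newtonD1 N s U : 'X %| U ->
  'X^(N.+1) %| (1 + U) * newton N s U - newton N (s + 1) U.
Proof.
by move=> XU; rewrite newtonD1 addrC addKr -mul_polyC dvdp_mull ?dvdp_exp2r.
Qed.

Lemma dvdX_newton_nat N m U : 'X %| U ->
  'X^(N.+1) %| newton N m%:R U - (1 + U) ^+ m.
Proof.
move=> XU; elim: m => [|m IH]; first by rewrite newton0 expr0 subrr dvdp0.
rewrite -natr1 [(1 + U) ^+ _]exprS.
rewrite (_ : _ - _ = (1 + U) * (newton N m%:R U - (1 + U) ^+ m) -
    ((1 + U) * newton N m%:R U - newton N (m%:R + 1) U)); last by ring.
by rewrite dvdp_sub ?dvdp_mull // dvdX_newtonD1.
Qed.

(** Here $1+V$ inverts $1+U$ modulo $v^{N+1}$, so $(1+V)^{-m}$ should be $(1+U)^m$. *)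
Lemma dvdX_newtonN_nat N m U V : 'X %| V ->
  'X^(N.+1) %| (1 + U) * (1 + V) - 1 ->
  'X^(N.+1) %| newton N (- m%:R) V - (1 + U) ^+ m.
Proof.
move=> XV inv; elim: m => [|m IH].
  by rewrite oppr0 newton0 expr0 subrr dvdp0.
have := dvdX_newtonD1 N (- m.+1%:R) XV.
have -> : - m.+1%:R + 1 = - m%:R :> R by rewrite -natr1; ring.
set a := newton N (- m%:R) V in IH *; set b := newton _ _ _ => D.
rewrite [(1 + U) ^+ _]exprS.
(* The three summands are divisible by the induction hypothesis, by [D] and by [inv],
   respectively. *)
rewrite (_ : _ - _ = (1 + U) * (a - (1 + U) ^+ m)
  + (1 + U) * ((1 + V) * b - a) - b * ((1 + U) * (1 + V) - 1)); last by ring.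
by rewrite dvdp_sub ?dvdp_add ?dvdp_mull.
Qed.

Lemma coef_dvdX N p q i : 'X^(N.+1) %| p - q -> (i <= N)%N -> p`_i = q`_i.
Proof.
move=> /dvdpP [r /eqP]; rewrite subr_eq => /eqP -> iN.
by rewrite coefD coefMXn ltnS iN add0r.
Qed.

(** The generalized binomial coefficient as a polynomial in its upper argument, so that identities
    extend from naturals to reals. *)
Definition gbinom_poly k : {poly R} :=
  k`!%:R^-1 *: \prod_(i < k) ('X - i%:R%:P).

Lemma horner_gbinom_poly k s : (gbinom_poly k).[s] = gbinom s k.
Proof.
rewrite hornerZ horner_prod mulrC; congr (_ / _).
by apply: eq_bigr => i _; rewrite hornerXsubC.
Qed.

Lemma poly_nat_eq0 p : (forall m : nat, p.[m%:R] = 0) -> p = 0.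
Proof.
(* These are [size p] distinct roots, one more than the degree of a nonzero [p] allows. *)
move=> p0; pose rs := [seq i%:R : R | i <- iota 0 (size p)].
apply: (@roots_geq_poly_eq0 _ _ rs).
- by apply/allP => _ /mapP [m _ ->]; rewrite /root p0.
- by rewrite map_inj_uniq ?iota_uniq //; exact: mulrIn (oner_neq0 _).
- by rewrite size_map size_iota.
Qed.

(** Both sides are polynomials in $s$; at each natural $s=m$ both equal the coefficient of
    $(1+U)^m$. *)
Lemma coef_newtonN N s U V : 'X %| U -> 'X %| V ->
  'X^(N.+1) %| (1 + U) * (1 + V) - 1 ->
  (newton N (- s) V)`_N = (newton N s U)`_N.
Proof.
move=> XU XV inv.
pose A : {poly R} := \sum_(k < N.+1) (U ^+ k)`_N *: gbinom_poly k.
pose B : {poly R} := \sum_(k < N.+1) (V ^+ k)`_N *: gbinom_poly k.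
have evA t : A.[t] = (newton N t U)`_N.
  rewrite /newton coef_sum horner_sum; apply: eq_bigr => k _.
  by rewrite hornerZ horner_gbinom_poly coefZ mulrC.
have evB t : (B \Po - 'X).[t] = (newton N (- t) V)`_N.
  rewrite horner_comp !hornerE /newton coef_sum horner_sum.
  by apply: eq_bigr => k _; rewrite hornerZ horner_gbinom_poly coefZ mulrC.
have /eqP : A - (B \Po - 'X) = 0.
  apply: poly_nat_eq0 => m; rewrite hornerD hornerN evA evB.
  rewrite (coef_dvdX (dvdX_newton_nat N m XU)) //.
  by rewrite (coef_dvdX (dvdX_newtonN_nat m XV inv)) // subrr.
by rewrite subr_eq0 -evA -evB => /eqP ->.
Qed.

End NewtonSeries.

(** * From power series to truncated polynomials *)

Section PowerSeries.
Variable R : realType.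
Implicit Types (f : fps R) (p U : {poly R}) (s : R) (N : nat).

Lemma coef_fps_expn N f p : (forall i, (i <= N)%N -> f i = p`_i) ->
  forall k i, (i <= N)%N -> fps_expn f k i = (p ^+ k)`_i.
Proof.
move=> fp; elim=> [|k IH] i iN; first by rewrite expr0 coef1.
rewrite exprS coefM; apply: eq_bigr => j _.
congr (_ * _); first by apply: fp; rewrite (leq_trans _ iN) // -ltnS.
by apply: IH; rewrite (leq_trans (leq_subr _ _)).
Qed.

Lemma dvdX_coef0 p : p`_0 = 0 -> 'X %| p.
Proof.
by move=> p0; rewrite -['X]subr0 -polyC0 dvdp_XsubCl /root horner_coef0 p0.
Qed.

Lemma coef_expr_small p k i : 'X %| p -> (i < k)%N -> (p ^+ k)`_i = 0.
Proof.
move=> Xp ik; have /dvdpP [r ->] : 'X^k %| p ^+ k by rewrite dvdp_exp2r.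
by rewrite coefMXn ik.
Qed.

Lemma fps_powrE N f U s : (forall i, (i <= N)%N -> f i = (1 + U)`_i) ->
  fps_powr f s N = (newton N s U)`_N.
Proof.
move=> fU; rewrite /fps_powr /newton coef_sum; apply: eq_bigr => k _.
rewrite coefZ; congr (_ * _); apply: (@coef_fps_expn N) => // i iN.
by rewrite /fps_sub /fps1 fU // coefD coef1 addrC addKr.
Qed.

Lemma fps_invE N f U : 'X %| U -> (forall i, (i <= N)%N -> f i = (1 + U)`_i) ->
  forall i, (i <= N)%N -> fps_inv f i = (\sum_(k < N.+1) (- U) ^+ k)`_i.
Proof.
move=> XU fU i iN; rewrite /fps_inv.
(* The sum for order $i$ is lengthened to a range independent of $i$; the added powers $(-U)^k$,
   $k>i$, have no coefficient at $i$. *)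
rewrite (big_ord_widen N.+1 (fun k => fps_expn _ k i)) // big_mkcond coef_sum.
apply: eq_bigr => k _ /=; case: ltnP => [ki|ik].
  apply: (@coef_fps_expn N) => // j jN.
  by rewrite /fps_sub /fps1 fU // coefD coef1 coefN opprD addNKr.
by rewrite coef_expr_small ?dvdpNr.
Qed.

Lemma fps_powr_inv f s n : f 0%N = 1 ->
  fps_powr (fps_inv f) (- s) n = fps_powr f s n.
Proof.
move=> f0; pose U : {poly R} := \poly_(i < n.+1) f i - 1.
have fU i : (i <= n)%N -> f i = (1 + U)`_i.
  by move=> le_in; rewrite /U addrC subrK coef_poly ltnS le_in.
have XU : 'X %| U.
  by apply: dvdX_coef0; rewrite coefB coef_poly /= f0 coef1 subrr.
pose V : {poly R} := \sum_(k < n.+1) (- U) ^+ k - 1.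
have XV : 'X %| V.
  rewrite /V big_ord_recl expr0 addrC addKr.
  apply: (big_ind (fun p => 'X %| p)) => [|p1 p2|i _]; first exact: dvdp0.
    exact: dvdp_add.
  by rewrite exprS dvdp_mulr // dvdpNr.
rewrite (fps_powrE _ fU) (fps_powrE (U := V)); last first.
  by rewrite /V addrC subrK; exact: fps_invE.
apply: coef_newtonN => //.
(* Since $1+V$ is the truncated geometric series in $-U$, the product telescopes. *)
have -> : (1 + U) * (1 + V) - 1 = - (- U) ^+ n.+1.
  rewrite /V; set S := \sum_(k < n.+1) _.
  have : (- U) ^+ n.+1 - 1 = (- U - 1) * S by exact: subrX1.
  by move/eqP; rewrite subr_eq => /eqP ->; ring.
by rewrite dvdpNr dvdp_exp2r ?dvdpNr.
Qed.
End PowerSeries.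

(** * Moment generating function of the uniform law *)

Section UniformMoments.
Variable R : realType.
Local Notation mu := (@lebesgue_measure R).

Lemma Rintegral_exprn01 n : \int[mu]_(y in `[0, 1]) (y ^+ n) = n.+1%:R^-1 :> R.
Proof.
(* The substitution $y\mapsto 1-y$ turns the integrand into $(1-y)^n$. *)
rewrite -(Rintegral_onemXn n) Rintegration_by_substitution_onem ?ler01 ?lexx //.
  by rewrite unstable.onem1.
by apply: continuous_subspaceT; exact: exprn_continuous.
Qed.

Lemma derive1n_mgf01 n (v : R) :
  derive1n n (fun v : R => \int[mu]_(y in `[0, 1]) expR (v * y)) v =
  \int[mu]_(y in `[0, 1]) (y ^+ n * expR (v * y)).
Proof.
elim: n v => [|n IH] v.
  by rewrite derive1n0; apply: eq_Rintegral => y _; rewrite expr0 mul1r.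
rewrite derive1nS (_ : derive1n n _ =
    fun v : R => \int[mu]_(y in `[0, 1]) (y ^+ n * expR (v * y)));
  last exact/funext.
have cont m (t : R) : continuous (fun y : R => y ^+ m * expR (t * y)).
  move=> y; apply: (@continuousM _ _ (fun y : R => y ^+ m)
    (fun y : R => expR (t * y))).
    exact: exprn_continuous.
  apply: continuous_comp; last exact: continuous_expR.
  exact: mulrl_continuous.
have dF (t y : R) : is_derive t 1 (fun t : R => y ^+ n * expR (t * y))
    (y ^+ n.+1 * expR (t * y)).
  apply: is_derive_eq.
  by rewrite /GRing.scale /= mulr0 add0r mulr1 exprSr mulrA mulrAC.
have d1 (t y : R) :
    partial1of2 (fun t y : R => y ^+ n * expR (t * y)) t y =
    y ^+ n.+1 * expR (t * y).
  by rewrite partial1of2E; exact: derive_val.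
(* For $|t-v|<1$ and $y\in[0,1]$ one has $y^{n+1}\le 1$ and $ty\le|v|+1$, which gives the constant
   dominating function. *)
rewrite (@differentiation_under_integral R _ _ mu
    (fun t y : R => y ^+ n * expR (t * y)) `[0%R, 1%R]%classic _ v
    (v - 1) (v + 1) _ _ _ (fun=> expR (`|v| + 1))) //.
- by apply: eq_Rintegral => y _; exact: d1.
- by rewrite /= in_itv /= ltrBlDr !ltrDl ltr01.
- move=> t _; apply: continuous_compact_integrable; first exact: segment_compact.
  exact: continuous_subspaceT.
- apply: continuous_compact_integrable; first exact: segment_compact.
  by apply: continuous_subspaceT; exact: cst_continuous.
- move=> t y; rewrite /= !in_itv /= => /andP[vt tv] /andP[y0 y1].
  rewrite d1 ger0_norm ?mulr_ge0 ?exprn_ge0 ?expR_ge0 //.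
  rewrite -[leRHS]mul1r ler_pM ?exprn_ge0 ?expR_ge0 ?exprn_ile1 // ler_expR.
  apply: le_trans (ler_norm _) _; rewrite normrM -[leRHS]mulr1 ler_pM //.
    rewrite -(subrK v t) addrC (le_trans (ler_normD _ _)) // lerD2l ltW //.
    by rewrite ltr_norml ltrBlDr ltrBrDr addrC vt addrC tv.
  by rewrite ger0_norm.
Qed.

(* The library equips [R] with two measurable structures that have the same
   measurable sets but different displays: the law of [Y] lives on the default
   one, [uniform_prob] on [measurableTypeR R], hence the transfer along the
   identity. *)
Lemma integral_uniform01 d (T : measurableType d) (P : probability T R)
    (Y : {RV P >-> R}) (f : R -> \bar R) :
  uniform01 Y -> measurable_fun [set: R] f -> (forall y, 0 <= f y)%E ->
  (\int[distribution P Y]_y f y = \int[mu]_(y in `[0%R, 1%R]) f y)%E.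
Proof.
move=> hY mf f0; pose idR : measurableTypeR R -> R := idfun.
have mid : measurable_fun [set: measurableTypeR R] idR by exact: measurable_id.
transitivity (\int[pushforward (uniform_prob (@ltr01 R)) idR]_y f y)%E.
  by apply: (eq_measure_integral (pushforward _ _)) => A mA _; exact: hY.
rewrite ge0_integral_pushforward // preimage_setT.
by rewrite integral_uniform // subr0 invr1 mul1e.
Qed.

Lemma uniform_mgf_fps d (T : measurableType d) (P : probability T R)
    (Y : {RV P >-> R}) : uniform01 Y -> mgf_fps Y = @expm1_div R.
Proof.
move=> hY.
have mgfE : (fun v : R => fine ('M_P Y v)) =
    (fun v : R => \int[mu]_(y in `[0, 1]) expR (v * y)).
  apply/funext => v; rewrite /Rintegral; congr fine.
  have mE : measurable_fun [set: R] (fun y : R => (expR (v * y))%:E).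
    apply/measurable_EFinP/(measurableT_comp (@measurable_expR R)).
    exact: mulrl_measurable.
  have E0 (y : R) : (0 <= (expR (v * y))%:E)%E by rewrite lee_fin expR_ge0.
  rewrite -(integral_uniform01 hY) // ge0_integral_distribution //.
  rewrite /mmt_gen_fun unlock.
  by apply: eq_integral => w _ /=; rewrite mulrC.
apply/funext => k; rewrite /mgf_fps /fps_taylor mgfE derive1n_mgf01.
(* At $v=0$ the exponential is 1, leaving the moment $1/(k+1)$; division by $k!$ gives
   $1/(k+1)!$. *)
under eq_Rintegral do rewrite mul0r expR0 mulr1.
by rewrite Rintegral_exprn01 /expm1_div factS natrM invfM.
Qed.
End UniformMoments.

(** * Monomial factor, reflection of $q$-numbers and conclusion *)

Lemma fps_mul_polyZXn (R : realType) (a : R) (f : fps R) (r n : nat) :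
  (r <= n)%N -> fps_mul (fps_poly (a *: 'X^r)) f n = a * f (n - r)%N.
Proof.
rewrite -ltnS => rn; rewrite /fps_mul (bigD1 (Ordinal rn)) //= big1 ?addr0.
  by rewrite /fps_poly coefZ coefXn eqxx mulr1.
move=> i; rewrite -val_eqE /= /fps_poly coefZ coefXn => /negbTE ->.
by rewrite mulr0 mul0r.
Qed.

Lemma qnum_onem (R : realType) (q x : R) : 0 < q -> q < 1 ->
  qnum q (1 - x) = - (qnum q^-1 x - 1).
Proof.
move=> q0 q1; rewrite /qnum powRB ?(gt_eqF q0) ?implybT // powRr1 ?ltW //.
have -> : q^-1 `^ x = (q `^ x)^-1.
  by rewrite -powR_inv1 ?ltW // -powRrM mulN1r powRN.
have p0 : q `^ x != 0 by rewrite gt_eqF // powR_gt0.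
have qn0 : q != 0 by rewrite gt_eqF.
have qn1 : q - 1 != 0 by rewrite subr_eq0 lt_eqF.
(* This denominator comes from $q^{-1}-1=(1-q)/q$. *)
have qn1' : 1 - q != 0 by rewrite subr_eq0 gt_eqF.
field.
by rewrite mulN1r qn0 qn1' p0 qn1.
Qed.

Theorem theorem3p7 (R : realType) (d : measure_display) (T : measurableType d)
    (P : probability T R) (Y : {RV P >-> R}) (q x : R) (n r : nat)
    (hY : uniform01 Y) (hq0 : 0 < q) (hq1 : q < 1)
    (hx0 : 0 <= x) (hx1 : x <= 1) (hrn : (r <= n)%N) :
  prob_qBernstein Y r n x q =
    'C(n, r)%:R * qnum q x ^+ r * bernoulli (qnum q^-1 x - 1) (n - r)%N.
Proof.
rewrite /prob_qBernstein (uniform_mgf_fps hY) exprZn scalerA fps_mul_polyZXn //.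
(* The double negation exhibits the Bernoulli order as $-s$ with $s=[1-x]_q$. *)
rewrite (qnum_onem x hq0 hq1) /bernoulli -[in RHS](opprK (_ - 1)).
rewrite fps_powr_inv; last by rewrite /expm1_div invr1.
have fr : r`!%:R != 0 :> R by rewrite pnatr_eq0 -lt0n fact_gt0.
(* With $n!=\binom{n}{r}\,r!\,(n-r)!$, the factor $1/r!$ cancels. *)
rewrite -(bin_fact hrn) !natrM.
by field.
Qed.
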